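(* For $\sigma>0$ let $F(a,b)=\operatorname{sgn}(\sigma)\,|A|^{\sigma}=(a^2+b^2)^{\sigma/2}$ for $a,b>0$, where $|A|=(a^2+b^2)^{1/2}$. If $\sigma\ge 11$, then there exists no maximum-principle function (MPF) for the normal velocity $F$. In fact, the same non-existence already holds for all $\sigma\ge 9.899$.
   Context: Notation: $\mathbb{R}^2_+=(0,\infty)^2$; subscripts $a,b$ denote partial derivatives. Normal velocity: a symmetric function $F\in C^2(\mathbb{R}^2_+)$, homogeneous of some degree $\sigma\in\mathbb{R}\setminus\{0\}$, with $F_a,F_b>0$ for all $a,b>0$. It is contracting if $F>0$ everywhere on $\mathbb{R}^2_+$ and expanding if $F<0$ everywhere on $\mathbb{R}^2_+$. Maximum-principle function (MPF) for a normal velocity $F$: a symmetric function $w\in C^2(\mathbb{R}^2_+)$, homogeneous of some degree $\chi\in\mathbb{R}\setminus\{0\}$, such that, with $\alpha=-w_a/w_b$ and $\alpha_a=\partial\alpha/\partial a$ (defined for $a\ne b$): (1) $w>0$ whenever $a\neq b$, and $w=0$ whenever $a=b$. (2) $\chi>0$ if $F$ is contracting, $\chi<0$ if $F$ is expanding. (3) $w_a<0$ for all $0<a<b$, and $w_a>0$ for all $0<b<a$. (4) For all $a,b>0$ (for $E_w,G_w$: $a\neq b$) one has $C_w(a,b)\le0$, $E_w(a,b)\le0$, $G_w(a,b)\le 0$, where $$C_w=w_a\,a\big((F_aa^2+F_bb^2)+(F-F_aa-F_bb)a\big)+w_b\,b\big((F_aa^2+F_bb^2)+(F-F_aa-F_bb)b\big),$$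 $$E_w=w_a(F_{aa}+2F_{ab}\alpha+F_{bb}\alpha^2)-F_a(w_{aa}+2w_{ab}\alpha+w_{bb}\alpha^2)+2\,\frac{w_bF_a-w_aF_b}{a-b}\,\alpha^2,$$ $$G_w=\frac1{\alpha^2}\Big(w_b(F_{aa}+2F_{ab}\alpha+F_{bb}\alpha^2)-F_b(w_{aa}+2w_{ab}\alpha+w_{bb}\alpha^2)+2\,\frac{w_bF_a-w_aF_b}{a-b}\Big).$$ (5) There are constants $c>0$, $d\in\mathbb{R}$ such that, evaluating $\alpha$ and $\alpha_a$ at $(a,b)=(\rho,1)$ with $0<\rho<1$: if $F$ is contracting, then either $\alpha=c$ and $\alpha_a=0$ for all sufficiently small $\rho$, or, as $\rho\to0$, $\alpha=\frac c\rho+o(\rho^{-1})$ and $\alpha_a=-\frac c{\rho^2}+o(\rho^{-1})$; if $F$ is expanding, then, as $\rho\to0$, either $\alpha=\frac c\rho+o(\rho^{-1})$ and $\alpha_a=-\frac c{\rho^2}+o(\rho^{-1})$, or $\alpha=\frac{c+d\rho}{\rho^2}+o(\rho^{-1})$ and $\alpha_a=-\frac{2c+d\rho}{\rho^3}+o(\rho^{-1})$. *)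

(* Defs.v *)
From Stdlib Require Import Reals Lra.
From Coquelicot Require Import Coquelicot.
Open Scope R_scope.

(* A function on the open quadrant (0,oo)^2 is a total function R -> R -> R of
   which only the values at positive arguments are used.  The quadrant is open,
   so the partial derivatives at its points only depend on these values. *)

Definition d_a (f : R -> R -> R) (a b : R) : R := Derive (fun x => f x b) a.
Definition d_b (f : R -> R -> R) (a b : R) : R := Derive (fun y => f a y) b.

Definition symmetric_quadrant (f : R -> R -> R) : Prop :=
  forall a b, 0 < a -> 0 < b -> f a b = f b a.

(* [ex_diff_n f 2 a b]: all partial derivatives of order at most 2 exist at
   (a,b) and are continuous there as functions of two variables. *)
Definition C2_quadrant (f : R -> R -> R) : Prop :=
  forall a b, 0 < a -> 0 < b -> ex_diff_n f 2 a b.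

Definition homogeneous_quadrant (k : R) (f : R -> R -> R) : Prop :=
  forall t a b, 0 < t -> 0 < a -> 0 < b ->
    f (t * a) (t * b) = Rpower t k * f a b.

Record normal_velocity : Type := NormalVelocity {
  nv_fun :> R -> R -> R;
  nv_sym : symmetric_quadrant nv_fun;
  nv_C2 : C2_quadrant nv_fun;
  nv_hom : exists k, k <> 0 /\ homogeneous_quadrant k nv_fun;
  nv_d_a_pos : forall a b, 0 < a -> 0 < b -> 0 < d_a nv_fun a b;
  nv_d_b_pos : forall a b, 0 < a -> 0 < b -> 0 < d_b nv_fun a b
}.

Definition contracting (F : R -> R -> R) : Prop :=
  forall a b, 0 < a -> 0 < b -> 0 < F a b.

Definition expanding (F : R -> R -> R) : Prop :=
  forall a b, 0 < a -> 0 < b -> F a b < 0.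

Definition alpha (w : R -> R -> R) (a b : R) : R := - d_a w a b / d_b w a b.

(* f_aa + 2 f_ab alpha + f_bb alpha^2, with the alpha of w *)
Definition second_along (w f : R -> R -> R) (a b : R) : R :=
  d_a (d_a f) a b + 2 * d_b (d_a f) a b * alpha w a b
  + d_b (d_b f) a b * alpha w a b ^ 2.

Definition C_term (F w : R -> R -> R) (a b : R) : R :=
  let Fa := d_a F a b in
  let Fb := d_b F a b in
  d_a w a b * a
    * ((Fa * a ^ 2 + Fb * b ^ 2) + (F a b - Fa * a - Fb * b) * a)
  + d_b w a b * b
    * ((Fa * a ^ 2 + Fb * b ^ 2) + (F a b - Fa * a - Fb * b) * b).

Definition E_term (F w : R -> R -> R) (a b : R) : R :=
  d_a w a b * second_along w F a b - d_a F a b * second_along w w a b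
  + 2 * ((d_b w a b * d_a F a b - d_a w a b * d_b F a b) / (a - b))
    * alpha w a b ^ 2.

Definition G_term (F w : R -> R -> R) (a b : R) : R :=
  / alpha w a b ^ 2
  * (d_b w a b * second_along w F a b - d_b F a b * second_along w w a b
     + 2 * ((d_b w a b * d_a F a b - d_a w a b * d_b F a b) / (a - b))).

(* f(rho) = g(rho) + o(1/rho) as rho decreases to 0 *)
Definition eq_up_to_o_inv (f g : R -> R) : Prop :=
  is_domin (at_right 0) (fun rho : R => / rho) (fun rho : R => f rho - g rho).

Definition boundary_asymptotics (F w : R -> R -> R) : Prop :=
  let al := fun rho => alpha w rho 1 in
  let al_a := fun rho => d_a (alpha w) rho 1 in
  exists c d : R, 0 < c /\
    (contracting F ->
       at_right 0 (fun rho => al rho = c /\ al_a rho = 0) \/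
       (eq_up_to_o_inv al (fun rho => c / rho) /\
        eq_up_to_o_inv al_a (fun rho => - (c / rho ^ 2)))) /\
    (expanding F ->
       (eq_up_to_o_inv al (fun rho => c / rho) /\
        eq_up_to_o_inv al_a (fun rho => - (c / rho ^ 2))) \/
       (eq_up_to_o_inv al (fun rho => (c + d * rho) / rho ^ 2) /\
        eq_up_to_o_inv al_a (fun rho => - ((2 * c + d * rho) / rho ^ 3)))).

(* w is a maximum-principle function for F *)
Record MPF (F : normal_velocity) (w : R -> R -> R) : Prop := {
  mpf_sym : symmetric_quadrant w;
  mpf_C2 : C2_quadrant w;
  mpf_hom : exists chi, chi <> 0 /\ homogeneous_quadrant chi w /\
    (contracting F -> 0 < chi) /\ (expanding F -> chi < 0);
  mpf_pos : forall a b, 0 < a -> 0 < b -> a <> b -> 0 < w a b;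
  mpf_diag : forall a, 0 < a -> w a a = 0;
  mpf_d_a_neg : forall a b, 0 < a -> a < b -> d_a w a b < 0;
  mpf_d_a_pos : forall a b, 0 < b -> b < a -> 0 < d_a w a b;
  mpf_C : forall a b, 0 < a -> 0 < b -> C_term F w a b <= 0;
  mpf_E : forall a b, 0 < a -> 0 < b -> a <> b -> E_term F w a b <= 0;
  mpf_G : forall a b, 0 < a -> 0 < b -> a <> b -> G_term F w a b <= 0;
  mpf_boundary : boundary_asymptotics F w
}.

Definition norm_A (a b : R) : R := sqrt (a ^ 2 + b ^ 2).

Definition A_power (sigma a b : R) : R :=
  sign sigma * Rpower (norm_A a b) sigma.

Lemma sum_sq_pos a b : 0 < a -> 0 < b -> 0 < a ^ 2 + b ^ 2.
Proof. intros; nra. Qed.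

Lemma A_power_eq sigma a b : 0 < sigma -> 0 < a -> 0 < b ->
  A_power sigma a b = Rpower (a ^ 2 + b ^ 2) (sigma / 2).
Proof.
intros hs ha hb. unfold A_power, norm_A.
rewrite (sign_eq_1 _ hs), Rmult_1_l, <- Rpower_sqrt by now apply sum_sq_pos.
rewrite Rpower_mult. f_equal. field.
Qed.

Lemma A_power_sym sigma : symmetric_quadrant (A_power sigma).
Proof. intros a b _ _. unfold A_power, norm_A. now rewrite Rplus_comm. Qed.

Lemma A_power_hom sigma : 0 < sigma ->
  homogeneous_quadrant sigma (A_power sigma).
Proof.
intros hs t a b ht ha hb.
rewrite !A_power_eq by (try apply Rmult_lt_0_compat; assumption).
replace ((t * a) ^ 2 + (t * b) ^ 2) with ((t * t) * (a ^ 2 + b ^ 2)) by ring.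
rewrite <- Rpower_mult_distr; [| nra | now apply sum_sq_pos].
f_equal. rewrite <- Rpower_mult_distr by assumption.
rewrite <- Rpower_plus. f_equal. field.
Qed.

Lemma locally_2d_quadrant a b : 0 < a -> 0 < b ->
  locally_2d (fun u v => 0 < u /\ 0 < v) a b.
Proof.
intros ha hb. exists (mkposreal _ (Rmin_pos _ _ ha hb)). simpl.
intros u v hu hv.
assert (Rabs (u - a) < a) by (eapply Rlt_le_trans; [exact hu | apply Rmin_l]).
assert (Rabs (v - b) < b) by (eapply Rlt_le_trans; [exact hv | apply Rmin_r]).
split; [revert H | revert H0]; unfold Rabs; destruct Rcase_abs; lra.
Qed.

Lemma continuity_2d_power s a b : 0 < a -> 0 < b ->
  continuity_2d_pt (fun u v => Rpower (u ^ 2 + v ^ 2) s) a b.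
Proof.
intros ha hb. assert (h := sum_sq_pos a b ha hb).
apply (continuity_1d_2d_pt_comp (fun z => Rpower z s)
         (fun u v => u ^ 2 + v ^ 2)).
- apply derivable_continuous_pt.
  exists (s * Rpower (a ^ 2 + b ^ 2) (s - 1)).
  now apply derivable_pt_lim_power.
- apply continuity_2d_pt_plus; simpl.
  + repeat apply continuity_2d_pt_mult;
      try apply continuity_2d_pt_const; apply continuity_2d_pt_id1.
  + repeat apply continuity_2d_pt_mult;
      try apply continuity_2d_pt_const; apply continuity_2d_pt_id2.
Qed.

Lemma ex_diff_n_S_quadrant f fa fb n :
  (forall a b, 0 < a -> 0 < b -> continuity_2d_pt f a b) ->
  (forall a b, 0 < a -> 0 < b -> is_derive (fun x => f x b) a (fa a b)) ->
  (forall a b, 0 < a -> 0 < b -> is_derive (fun y => f a y) b (fb a b)) ->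
  (forall a b, 0 < a -> 0 < b -> ex_diff_n fa n a b) ->
  (forall a b, 0 < a -> 0 < b -> ex_diff_n fb n a b) ->
  forall a b, 0 < a -> 0 < b -> ex_diff_n f (S n) a b.
Proof.
intros hc ha hb hfa hfb a b pa pb. simpl. repeat split.
- now apply hc.
- exists (fa a b); now apply ha.
- exists (fb a b); now apply hb.
- apply (ex_diff_n_ext_loc fa); [| now apply hfa].
  destruct (locally_2d_quadrant a b pa pb) as [e he]. exists e.
  intros u v hu hv. destruct (he u v hu hv) as [pu pv].
  symmetry. now apply is_derive_unique, ha.
- apply (ex_diff_n_ext_loc fb); [| now apply hfb].
  destruct (locally_2d_quadrant a b pa pb) as [e he]. exists e.
  intros u v hu hv. destruct (he u v hu hv) as [pu pv].
  symmetry. now apply is_derive_unique, hb.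
Qed.

Lemma is_derive_power_a s a b : 0 < a -> 0 < b ->
  is_derive (fun x => Rpower (x ^ 2 + b ^ 2) s) a
    (2 * s * a * Rpower (a ^ 2 + b ^ 2) (s - 1)).
Proof.
intros ha hb. assert (h := sum_sq_pos a b ha hb).
unfold Rpower. auto_derive; [simpl in h; nra |].
replace ((s - 1) * ln (a ^ 2 + b ^ 2))
  with (s * ln (a ^ 2 + b ^ 2) + - ln (a ^ 2 + b ^ 2)) by ring.
rewrite exp_plus, exp_Ropp, exp_ln by assumption.
simpl. field. simpl in h. nra.
Qed.

Lemma is_derive_power_b s a b : 0 < a -> 0 < b ->
  is_derive (fun y => Rpower (a ^ 2 + y ^ 2) s) b
    (2 * s * b * Rpower (a ^ 2 + b ^ 2) (s - 1)).
Proof.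
intros ha hb.
apply (is_derive_ext (fun y => Rpower (y ^ 2 + a ^ 2) s)).
- intros t. f_equal. apply Rplus_comm.
- rewrite (Rplus_comm (a ^ 2)). now apply is_derive_power_a.
Qed.

Lemma continuity_2d_mult_power (P : R -> R -> R) s a b :
  0 < a -> 0 < b -> continuity_2d_pt P a b ->
  continuity_2d_pt (fun u v => P u v * Rpower (u ^ 2 + v ^ 2) s) a b.
Proof.
intros ha hb hP.
apply continuity_2d_pt_mult; [exact hP | now apply continuity_2d_power].
Qed.

Ltac poly_cont :=
  repeat first [apply continuity_2d_pt_plus | apply continuity_2d_pt_mult
    | apply continuity_2d_pt_const | apply continuity_2d_pt_id1
    | apply continuity_2d_pt_id2].

Lemma ex_diff_1_linear_power p q s a b : 0 < a -> 0 < b ->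
  ex_diff_n (fun u v => (p * u + q * v) * Rpower (u ^ 2 + v ^ 2) s) 1 a b.
Proof.
revert a b.
apply (ex_diff_n_S_quadrant _
  (fun u v => p * Rpower (u ^ 2 + v ^ 2) s
     + (p * u + q * v) * (2 * s * u) * Rpower (u ^ 2 + v ^ 2) (s - 1))
  (fun u v => q * Rpower (u ^ 2 + v ^ 2) s
     + (p * u + q * v) * (2 * s * v) * Rpower (u ^ 2 + v ^ 2) (s - 1))).
- intros a b ha hb.
  apply (continuity_2d_mult_power (fun u v => p * u + q * v)); auto; poly_cont.
- intros a b ha hb. rewrite Rmult_assoc.
  apply (is_derive_mult (fun u => p * u + q * b)
           (fun u => Rpower (u ^ 2 + b ^ 2) s) a p).
  + auto_derive; [exact I | ring].
  + now apply is_derive_power_a.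
  + intros; apply Rmult_comm.
- intros a b ha hb. rewrite Rmult_assoc.
  apply (is_derive_mult (fun v => p * a + q * v)
           (fun v => Rpower (a ^ 2 + v ^ 2) s) b q).
  + auto_derive; [exact I | ring].
  + now apply is_derive_power_b.
  + intros; apply Rmult_comm.
- intros a b ha hb. split; [| exact I]. apply continuity_2d_pt_plus.
  + apply (continuity_2d_mult_power (fun u v => p)); auto; poly_cont.
  + apply (continuity_2d_mult_power
      (fun u v => (p * u + q * v) * (2 * s * u))); auto; poly_cont.
- intros a b ha hb. split; [| exact I]. apply continuity_2d_pt_plus.
  + apply (continuity_2d_mult_power (fun u v => q)); auto; poly_cont.
  + apply (continuity_2d_mult_power
      (fun u v => (p * u + q * v) * (2 * s * v))); auto; poly_cont.
Qed.

Lemma is_derive_A_power_a sigma a b : 0 < sigma -> 0 < a -> 0 < b ->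
  is_derive (fun x => A_power sigma x b) a
    (sigma * a * Rpower (a ^ 2 + b ^ 2) (sigma / 2 - 1)).
Proof.
intros hs ha hb.
apply (is_derive_ext_loc (fun x => Rpower (x ^ 2 + b ^ 2) (sigma / 2))).
- apply (filter_imp (fun x => 0 < x)); [| apply (open_gt 0 a ha)].
  intros x hx. symmetry. now apply A_power_eq.
- replace (sigma * a) with (2 * (sigma / 2) * a) by field.
  now apply is_derive_power_a.
Qed.

Lemma is_derive_A_power_b sigma a b : 0 < sigma -> 0 < a -> 0 < b ->
  is_derive (fun y => A_power sigma a y) b
    (sigma * b * Rpower (a ^ 2 + b ^ 2) (sigma / 2 - 1)).
Proof.
intros hs ha hb.
apply (is_derive_ext_loc (fun y => Rpower (a ^ 2 + y ^ 2) (sigma / 2))).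
- apply (filter_imp (fun y => 0 < y)); [| apply (open_gt 0 b hb)].
  intros y hy. symmetry. now apply A_power_eq.
- replace (sigma * b) with (2 * (sigma / 2) * b) by field.
  now apply is_derive_power_b.
Qed.

Lemma A_power_C2 sigma : 0 < sigma -> C2_quadrant (A_power sigma).
Proof.
intros hs. unfold C2_quadrant.
apply (ex_diff_n_S_quadrant _
  (fun u v => sigma * u * Rpower (u ^ 2 + v ^ 2) (sigma / 2 - 1))
  (fun u v => sigma * v * Rpower (u ^ 2 + v ^ 2) (sigma / 2 - 1))).
- intros a b ha hb.
  apply (continuity_2d_pt_ext_loc
           (fun u v => Rpower (u ^ 2 + v ^ 2) (sigma / 2)));
    [| now apply continuity_2d_power].
  destruct (locally_2d_quadrant a b ha hb) as [e he]. exists e.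
  intros u v hu hv. destruct (he u v hu hv) as [pu pv].
  symmetry. now apply A_power_eq.
- intros a b ha hb. now apply is_derive_A_power_a.
- intros a b ha hb. now apply is_derive_A_power_b.
- intros a b ha hb.
  apply (ex_diff_n_ext_loc (fun u v => (sigma * u + 0 * v)
           * Rpower (u ^ 2 + v ^ 2) (sigma / 2 - 1)));
    [| now apply ex_diff_1_linear_power].
  exists (mkposreal 1 Rlt_0_1). intros u v _ _. ring.
- intros a b ha hb.
  apply (ex_diff_n_ext_loc (fun u v => (0 * u + sigma * v)
           * Rpower (u ^ 2 + v ^ 2) (sigma / 2 - 1)));
    [| now apply ex_diff_1_linear_power].
  exists (mkposreal 1 Rlt_0_1). intros u v _ _. ring.
Qed.

Lemma A_power_d_a_pos sigma : 0 < sigma ->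
  forall a b, 0 < a -> 0 < b -> 0 < d_a (A_power sigma) a b.
Proof.
intros hs a b ha hb.
apply (Rlt_le_trans _ (sigma * a * Rpower (a ^ 2 + b ^ 2) (sigma / 2 - 1)));
  [| right; symmetry; now apply is_derive_unique, is_derive_A_power_a].
repeat apply Rmult_lt_0_compat; try assumption. apply exp_pos.
Qed.

Lemma A_power_d_b_pos sigma : 0 < sigma ->
  forall a b, 0 < a -> 0 < b -> 0 < d_b (A_power sigma) a b.
Proof.
intros hs a b ha hb.
apply (Rlt_le_trans _ (sigma * b * Rpower (a ^ 2 + b ^ 2) (sigma / 2 - 1)));
  [| right; symmetry; now apply is_derive_unique, is_derive_A_power_b].
repeat apply Rmult_lt_0_compat; try assumption. apply exp_pos.
Qed.

Definition A_power_velocity (sigma : R) (hs : 0 < sigma) : normal_velocity :=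
  NormalVelocity (A_power sigma) (A_power_sym sigma) (A_power_C2 sigma hs)
    (ex_intro _ sigma
       (conj (Rgt_not_eq _ _ hs) (A_power_hom sigma hs)))
    (A_power_d_a_pos sigma hs) (A_power_d_b_pos sigma hs).

(* Main.v *)
(** By homogeneity alpha is a function of rho = a/b, and 0 < beta < 1 for
    beta rho = rho * alpha(rho,1), 0 < rho < 1.  The condition G_w <= 0 becomes
    rho * beta' * (1 - beta) <= rate sigma rho beta, and the right-hand side
    decreases in sigma, so it suffices to treat sigma = 9.899.  For that sigma
    the explicit polynomial [barrier] is a strict supersolution on (0, 29/50]
    which is negative at 29/50.  Since beta (29/50) > 0, and a subsolution
    cannot cross [barrier] upwards, beta > barrier on all of (0, 29/50].  But
    barrier 0 exceeds 1/sigma, the stationary value of the equation at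
    rho = 0, so there rho * beta' is bounded above by a negative constant and
    beta grows logarithmically as rho -> 0, contradicting beta < 1. *)

Require Import Defs.
From Stdlib Require Import Reals Lra.
From Coquelicot Require Import Coquelicot.
Open Scope R_scope.

(** * The right-hand side of the differential inequality *)

(** At [r = 0] this is [y * (1 - sigma * y)], whence the stationary value [1 / sigma]. *)
Definition rate (sigma r y : R) : R :=
  y * (1 - y) + 2 * r * (r ^ 2 + y) / (1 - r) - r ^ 2 - y ^ 2
  - (sigma - 2) * (r ^ 2 + y) ^ 2 / (1 + r ^ 2).

Lemma rate_decr sigma tau r y : sigma <= tau -> rate tau r y <= rate sigma r y.
Proof.
intros h. unfold rate.
assert (0 <= (r ^ 2 + y) ^ 2 / (1 + r ^ 2)).
{ apply Rmult_le_pos; [apply pow2_ge_0 |].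
  apply Rlt_le, Rinv_0_lt_compat. nra. }
unfold Rdiv in *. rewrite !Rmult_assoc in *. nra.
Qed.

(** * Comparison principle *)

(** If [e b > 0], let [z] be the supremum of the points where [e <= 0]. Continuity rules out
    [e z > 0]; otherwise [e <= 0] persists slightly to the right of [z], by continuity if [e z < 0]
    and by the negative derivative if [e z = 0]. *)
Lemma barrier_persist (e de : R -> R) (a b : R) :
  a <= b ->
  (forall x, a <= x <= b -> is_derive e x (de x)) ->
  (forall x, a <= x <= b -> e x = 0 -> de x < 0) ->
  e a <= 0 -> e b <= 0.
Proof.
intros hab hd hneg ha.
destruct (Rle_lt_dec (e b) 0) as [|hb]; [assumption | exfalso].
destruct (completeness (fun x => a <= x <= b /\ e x <= 0)) as [z [zub zlub]].
{ exists b. intros x [hx _]. lra. }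
{ exists a. lra. }
assert (haz : a <= z) by (apply zub; lra).
assert (hzb : z <= b) by (apply zlub; intros x [hx _]; lra).
assert (hz := hd z (conj haz hzb)).
assert (hc : continuous e z).
{ apply (ex_derive_continuous (V := R_NormedModule)). eexists. exact hz. }
destruct (Rlt_le_dec 0 (e z)) as [pos | npos].
- assert (near : locally z (fun x => 0 < e x)).
  { apply (hc (fun y => 0 < y)). exact (open_gt 0 _ pos). }
  destruct near as [eps heps].
  assert (z <= z - eps / 2); [| assert (h := cond_pos eps); lra].
  apply zlub. intros x [hx hex].
  destruct (Rle_lt_dec x (z - eps / 2)) as [|hlt]; [assumption | exfalso].
  assert (hxz : x <= z) by (apply zub; split; assumption).
  assert (hp : 0 < e x); [| lra].
  apply heps. change (Rabs (x - z) < eps).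
  assert (h := cond_pos eps). apply Rabs_def1; lra.
- assert (hzb' : z < b) by (destruct hzb as [|<-]; lra).
  assert (hright : exists d : posreal, forall x, z < x < z + d -> e x <= 0).
  { destruct npos as [neg | zero].
    - assert (near : locally z (fun x => e x < 0)).
      { apply (hc (fun y => y < 0)). exact (open_lt 0 _ neg). }
      destruct near as [eps heps].
      exists eps. intros x hx. apply Rlt_le, heps.
      change (Rabs (x - z) < eps). apply Rabs_def1; lra.
    - assert (hdz := hneg z (conj haz hzb) zero).
      apply is_derive_Reals in hz.
      (* With tolerance [- de z] the difference quotients near [z] are still negative. *)
      destruct (hz (- de z)) as [d h]; [lra |].
      exists d. intros x hx. specialize (h (x - z)).
      replace (z + (x - z)) with x in h by ring.
      rewrite zero in h.
      assert (hq : Rabs ((e x - 0) / (x - z) - de z) < - de z).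
      { apply h; [lra | apply Rabs_def1; lra]. }
      apply Rabs_def2 in hq. destruct hq as [hq _].
      assert (hs : (e x - 0) / (x - z) < 0) by lra.
      replace (e x) with ((e x - 0) / (x - z) * (x - z)) by (field; lra).
      nra. }
  destruct hright as [d h]. assert (hd0 := cond_pos d).
  set (x := Rmin b (z + d / 2)).
  assert (z < x <= b /\ x <= z + d / 2).
  { unfold x. repeat split;
      [apply Rmin_glb_lt; lra | apply Rmin_l | apply Rmin_r]. }
  assert (x <= z); [| lra].
  apply zub. split; [lra |]. apply h. lra.
Qed.

(** * The polynomial barrier *)

(* A quartic fit to the solution of the equality case of the differential
   inequality, started slightly above its stationary value 1000/9899. *)
Definition barrier (r : R) : R :=
  106 / 1000 + 11 / 100 * r - 71 / 100 * r ^ 2 - 345 / 1000 * r ^ 3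
  + 1203 / 1000 * r ^ 4.

Definition d_barrier (r : R) : R :=
  11 / 100 - 142 / 100 * r - 1035 / 1000 * r ^ 2 + 4812 / 1000 * r ^ 3.

Lemma is_derive_barrier r : is_derive barrier r (d_barrier r).
Proof. unfold barrier, d_barrier. auto_derive; [exact I | field]. Qed.

Lemma barrier_supersolution r : 0 < r <= 29 / 50 ->
  rate (9899 / 1000) r (barrier r) < r * d_barrier r * (1 - barrier r).
Proof.
intros hr.
(* [M] is the difference of the two sides, cleared of denominators by the factor
   [10^9 * (1 - r) * (1 + r^2)]. *)
set (M := 5225164 + 1959516 * r + 210075740 * r ^ 2 - 2284727080 * r ^ 3
  + 7153347824 * r ^ 4 - 9497871724 * r ^ 5 + 13011852295 * r ^ 6
  - 19744759665 * r ^ 7 + 15815218821 * r ^ 8 - 8881215891 * r ^ 9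
  - 4139523000 * r ^ 10 + 2894418000 * r ^ 11).
assert (hM : 0 < M).
(* Since [29 = v + 50 * r], the product [29 ^ 11 * M] is a form of degree 11 in the nonnegative
   quantities [r] and [v]. *)
{ set (v := 29 - 50 * r).
  assert (hpos : forall i j, 0 <= r ^ i * v ^ j).
  { intros i j. apply Rmult_le_pos; apply pow_le; unfold v; lra. }
  (* All coefficients of [M] in the Bernstein basis of [0, 29/50] are
     positive. *)
  assert (cert : 29 ^ 11 * M =
       5225164 * (r ^ 0 * v ^ 11)
       + 2930666164 * (r ^ 1 * v ^ 10)
       + 923546729340 * (r ^ 2 * v ^ 9)
       + 137942883498880 * (r ^ 3 * v ^ 8)
       + 10300466471258544 * (r ^ 4 * v ^ 7)
       + 359473528225039524 * (r ^ 5 * v ^ 6)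
       + 6185264847821668895 * (r ^ 6 * v ^ 5)
       + 535510233427882797265 * (r ^ 7 * v ^ 4)
       + 48756228953125692616981 * (r ^ 8 * v ^ 3)
       + 1814164282074243211987871 * (r ^ 9 * v ^ 2)
       + 24953348347435431791056600 * (r ^ 10 * v ^ 1)
       + 13244512159221355149549500 * (r ^ 11 * v ^ 0)).
  { unfold M, v. ring. }
  apply Rmult_lt_reg_l with (29 ^ 11); [apply pow_lt; lra |].
  (* Strictness comes from the pure [r ^ 11] term, the only one that survives at [r = 29/50]. *)
  rewrite Rmult_0_r, cert. apply Rplus_le_lt_0_compat.
  - repeat apply Rplus_le_le_0_compat;
      (apply Rmult_le_pos; [lra | apply hpos]).
  - apply Rmult_lt_0_compat; [lra |]. rewrite pow_O, Rmult_1_r.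
    apply pow_lt; lra. }
apply Rlt_0_minus.
replace (r * d_barrier r * (1 - barrier r) - rate (9899 / 1000) r (barrier r))
  with (M / 1000000000 / ((1 - r) * (1 + r ^ 2)))
  by (unfold M, rate, barrier, d_barrier; field; split; nra).
apply Rdiv_lt_0_compat; nra.
Qed.

(** * Blow-up at the origin *)

(** At [r = 0] the value [y * (1 - 9.899 * y)] is at most about -0.005 for [y >= 0.106]; the bounds
    [h1] and [h2] show that the terms in [r] do not use up this margin. *)
Lemma rate_neg_near_0 r y : 0 < r <= 1 / 1000 -> 106 / 1000 <= y <= 1 ->
  rate (9899 / 1000) r y <= - (1 / 1000).
Proof.
intros hr hy. unfold rate.
assert (h1 : 2 * r * (r ^ 2 + y) / (1 - r) <= 3 * r * (r + y)).
{ apply Rle_div_l; [lra |]. nra. }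
assert (h2 : (1 - r) * y ^ 2 <= (r ^ 2 + y) ^ 2 / (1 + r ^ 2)).
{ apply (Rle_div_r ((1 - r) * y ^ 2)); [nra |].
  assert ((1 - r) * (1 + r ^ 2) <= 1) by nra.
  assert (y ^ 2 <= (r ^ 2 + y) ^ 2) by nra.
  apply Rle_trans with ((1 - r) * (1 + r ^ 2) * y ^ 2); [lra |].
  apply Rle_trans with (1 * y ^ 2); [| lra].
  apply Rmult_le_compat_r; [apply pow2_ge_0 | assumption]. }
replace ((9899 / 1000 - 2) * (r ^ 2 + y) ^ 2 / (1 + r ^ 2))
  with (7899 / 1000 * ((r ^ 2 + y) ^ 2 / (1 + r ^ 2))) by (field; nra).
nra.
Qed.

Lemma no_subsolution (f df : R -> R) :
  (forall r, 0 < r < 1 -> is_derive f r (df r)) ->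
  (forall r, 0 < r < 1 -> 0 < f r < 1) ->
  (forall r, 0 < r < 1 ->
     r * df r * (1 - f r) <= rate (9899 / 1000) r (f r)) ->
  False.
Proof.
intros hd hf hrate.
assert (above : forall r, 0 < r <= 29 / 50 -> barrier r < f r).
{ intros r hr. apply Rnot_le_lt. intros hle.
  assert (h : f (29 / 50) - barrier (29 / 50) <= 0).
  { apply (barrier_persist (fun x => f x - barrier x)
             (fun x => df x - d_barrier x) r); try lra.
    - intros x hx. apply (is_derive_minus f barrier);
        [apply hd; lra | apply is_derive_barrier].
    - intros x hx heq.
      assert (h1 := hrate x ltac:(lra)). assert (h2 := hf x ltac:(lra)).
      assert (h3 := barrier_supersolution x ltac:(lra)).
      replace (barrier x) with (f x) in h3 by lra.
      assert (0 < x * (1 - f x)) by (apply Rmult_lt_0_compat; lra). nra. }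
  assert (h1 := hf (29 / 50) ltac:(lra)). unfold barrier in h. lra. }
assert (hdf : forall r, 0 < r <= 1 / 1000 -> df r <= - (1 / 1000) / r).
{ intros r hr. apply Rle_div_r; [lra |].
  assert (h1 := hrate r ltac:(lra)). assert (h2 := hf r ltac:(lra)).
  assert (h3 := above r ltac:(lra)).
  assert (106 / 1000 <= barrier r) by (unfold barrier; nra).
  assert (h4 := rate_neg_near_0 r (f r) ltac:(lra) ltac:(lra)).
  nra. }
(* By [hdf] the function [f + b * ln] is nonincreasing on [[a, b]]. The choice of [a] makes
   [b * (ln b - ln a) = 1], so [f a >= f b + 1 > 1]. *)
set (b := 1 / 1000). set (a := b * exp (- 1000)).
assert (hb : 0 < b) by (unfold b; lra).
assert (ha : 0 < a) by (apply Rmult_lt_0_compat; [lra | apply exp_pos]).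
assert (hab : a < b).
{ assert (exp (- 1000) < 1) by (rewrite <- exp_0; apply exp_increasing; lra).
  unfold a. nra. }
assert (hder : forall x, a <= x <= b ->
  is_derive (fun x => f x + b * ln x) x (df x + b * / x)).
{ intros x hx. apply (is_derive_plus f (fun x => b * ln x)).
  - apply hd. unfold b in *. lra.
  - apply is_derive_scal, is_derive_ln. lra. }
destruct (MVT_gen (fun x => f x + b * ln x) a b (fun x => df x + b * / x))
  as [c [hc heq]].
- rewrite Rmin_left, Rmax_right by lra. intros x hx. apply hder. lra.
- rewrite Rmin_left, Rmax_right by lra. intros x hx.
  apply derivable_continuous_pt. eexists. apply is_derive_Reals, hder, hx.
- rewrite Rmin_left, Rmax_right in hc by lra.
  assert (h1 := hdf c). fold b in h1. specialize (h1 ltac:(lra)).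
  replace (ln a) with (ln b - 1000) in heq
    by (unfold a; rewrite ln_mult, ln_exp by (assumption || apply exp_pos); ring).
  assert (h2 := hf a). assert (h3 := hf b).
  unfold Rdiv in h1. unfold b in *. nra.
Qed.

(** * Derivatives of homogeneous functions on the line b = 1 *)

(* [f] is homogeneous of degree [k] and [g] is its restriction to [b = 1]. *)
Definition profile (k : R) (f : R -> R -> R) (g : R -> R) : Prop :=
  forall a b, 0 < a -> 0 < b -> f a b = Rpower b k * g (a / b).

Lemma Rpower_pred b k : 0 < b -> Rpower b (k - 1) = Rpower b k / b.
Proof.
intros hb. unfold Rminus. rewrite Rpower_plus, Rpower_Ropp, Rpower_1; trivial.
Qed.

Lemma profile_at_1 k f g x : profile k f g -> 0 < x -> f x 1 = g x.
Proof.
intros h hx. rewrite (h x 1 hx Rlt_0_1).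
unfold Rpower. rewrite ln_1, Rmult_0_r, exp_0, Rdiv_1_r. ring.
Qed.

Lemma homogeneous_profile k f :
  homogeneous_quadrant k f -> profile k f (fun x => f x 1).
Proof.
intros h a b ha hb.
rewrite <- h by (try apply Rdiv_lt_0_compat; lra).
f_equal; field; lra.
Qed.

Lemma d_a_profile k f g dg :
  profile k f g -> (forall x, 0 < x -> is_derive g x (dg x)) ->
  profile (k - 1) (d_a f) dg.
Proof.
intros h hg a b ha hb. unfold d_a. apply is_derive_unique.
apply (is_derive_ext_loc (fun x => Rpower b k * g (x / b))).
- apply (filter_imp (fun x => 0 < x)); [| apply (open_gt 0 a ha)].
  intros x hx. symmetry. now apply h.
- rewrite Rpower_pred by assumption.
  replace (Rpower b k / b * dg (a / b)) with (Rpower b k * (/ b * dg (a / b)))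
    by (field; lra).
  apply is_derive_scal, (is_derive_comp g (fun x => x / b)).
  + apply hg. now apply Rdiv_lt_0_compat.
  + auto_derive; [exact I | field; lra].
Qed.

(** On the line [b = 1] this is Euler's relation [x * f_a + f_b = k * f]. *)
Lemma d_b_profile k f g dg :
  profile k f g -> (forall x, 0 < x -> is_derive g x (dg x)) ->
  profile (k - 1) (d_b f) (fun x => k * g x - x * dg x).
Proof.
intros h hg a b ha hb. unfold d_b. apply is_derive_unique.
apply (is_derive_ext_loc (fun y => Rpower y k * g (a / y))).
- apply (filter_imp (fun y => 0 < y)); [| apply (open_gt 0 b hb)].
  intros y hy. symmetry. now apply h.
- replace (Rpower b (k - 1) * (k * g (a / b) - a / b * dg (a / b)))
    with (k * Rpower b (k - 1) * g (a / b)
          + Rpower b k * (- a / b ^ 2 * dg (a / b)))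
    by (rewrite Rpower_pred by assumption; field; lra).
  apply (is_derive_mult (fun y => Rpower y k) (fun y => g (a / y)) b).
  + now apply is_derive_Reals, derivable_pt_lim_power.
  + apply (is_derive_comp g (fun y => a / y)).
    * apply hg. now apply Rdiv_lt_0_compat.
    * auto_derive; [lra | field; lra].
  + intros; apply Rmult_comm.
Qed.

Lemma is_derive_d_b_profile k g dg ddg :
  (forall x, 0 < x -> is_derive g x (dg x)) ->
  (forall x, 0 < x -> is_derive dg x (ddg x)) ->
  forall x, 0 < x ->
    is_derive (fun x => k * g x - x * dg x) x ((k - 1) * dg x - x * ddg x).
Proof.
intros hg hdg x hx.
replace ((k - 1) * dg x - x * ddg x)
  with (k * dg x - (1 * dg x + x * ddg x)) by ring.
apply (is_derive_minus (fun x => k * g x) (fun x => x * dg x)).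
- now apply is_derive_scal, hg.
- apply (is_derive_mult (fun x => x) dg); [| now apply hdg |].
  + apply (is_derive_id (K := R_AbsRing)).
  + intros; apply Rmult_comm.
Qed.

(** Split the direction as [(1, alpha) = (1 - x * alpha) (1, 0) + alpha (x, 1)]. By Euler's
    relation, pairing the radial vector [(x, 1)] in the Hessian with [(1, 0)] gives [(k - 1) * f_a],
    and with itself [k * (k - 1) * f]. *)
Lemma second_along_profile w k f g dg ddg x :
  profile k f g ->
  (forall x, 0 < x -> is_derive g x (dg x)) ->
  (forall x, 0 < x -> is_derive dg x (ddg x)) ->
  0 < x ->
  second_along w f x 1 =
    ddg x * (1 - x * alpha w x 1) ^ 2
    + 2 * (k - 1) * dg x * alpha w x 1 * (1 - x * alpha w x 1)
    + k * (k - 1) * g x * alpha w x 1 ^ 2.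
Proof.
intros h hg hdg hx. unfold second_along.
assert (ha := d_a_profile k f g dg h hg).
assert (hb := d_b_profile k f g dg h hg).
assert (hq := is_derive_d_b_profile k g dg ddg hg hdg).
rewrite (profile_at_1 _ _ _ x (d_a_profile _ _ _ _ ha hdg) hx).
rewrite (profile_at_1 _ _ _ x (d_b_profile _ _ _ _ ha hdg) hx).
rewrite (profile_at_1 _ _ _ x (d_b_profile _ _ _ _ hb hq) hx).
ring.
Qed.

Lemma C2_is_derive_restriction w : C2_quadrant w ->
  (forall x, 0 < x -> is_derive (fun x => w x 1) x (d_a w x 1)) /\
  (forall x, 0 < x -> is_derive (fun x => d_a w x 1) x (d_a (d_a w) x 1)).
Proof.
intros h. split; intros x hx; destruct (h x 1 hx Rlt_0_1) as [_ [h1 [_ [h2 _]]]].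
- apply Derive_correct, h1.
- destruct h2 as [_ [h2 _]]. apply Derive_correct, h2.
Qed.

(** * Derivatives of the power of |A| *)

Lemma A_power_contracting sigma : 0 < sigma -> contracting (A_power sigma).
Proof. intros hs a b ha hb. rewrite A_power_eq by assumption. apply exp_pos. Qed.

(** All these derivatives share the positive factor [K = sigma * (1 + x^2)^(sigma/2 - 2)], which
    drops out of a sign condition and leaves rational expressions. *)
Lemma A_power_reduced sigma x : 0 < sigma -> 0 < x ->
  exists K, 0 < K /\
    d_a (A_power sigma) x 1 = K * x * (1 + x ^ 2) /\
    d_b (A_power sigma) x 1 = K * (1 + x ^ 2) /\
    forall w, second_along w (A_power sigma) x 1
      = K * ((1 + x ^ 2) * (1 + alpha w x 1 ^ 2)
             + (sigma - 2) * (x + alpha w x 1) ^ 2).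
Proof.
intros hs hx.
set (g := fun x => Rpower (x ^ 2 + 1 ^ 2) (sigma / 2)).
set (dg := fun x => sigma * x * Rpower (x ^ 2 + 1 ^ 2) (sigma / 2 - 1)).
set (ddg := fun x => sigma * Rpower (x ^ 2 + 1 ^ 2) (sigma / 2 - 1)
  + sigma * x * (2 * (sigma / 2 - 1) * x
                 * Rpower (x ^ 2 + 1 ^ 2) (sigma / 2 - 1 - 1))).
assert (h : profile sigma (A_power sigma) g).
{ intros a b ha hb. rewrite (homogeneous_profile _ _ (A_power_hom sigma hs))
    by assumption.
  rewrite A_power_eq; [reflexivity | | apply Rdiv_lt_0_compat |]; lra. }
assert (hg : forall x, 0 < x -> is_derive g x (dg x)).
{ intros y hy. unfold dg.
  replace (sigma * y) with (2 * (sigma / 2) * y) by field.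
  apply is_derive_power_a; lra. }
assert (hdg : forall x, 0 < x -> is_derive dg x (ddg x)).
{ intros y hy. apply (is_derive_mult (fun x => sigma * x)
    (fun x => Rpower (x ^ 2 + 1 ^ 2) (sigma / 2 - 1)) y sigma).
  - auto_derive; [exact I | ring].
  - apply is_derive_power_a; lra.
  - intros; apply Rmult_comm. }
assert (hS := sum_sq_pos x 1 hx Rlt_0_1).
exists (sigma * Rpower (x ^ 2 + 1 ^ 2) (sigma / 2 - 1 - 1)).
assert (e1 : Rpower (x ^ 2 + 1 ^ 2) (sigma / 2 - 1)
  = (x ^ 2 + 1 ^ 2) * Rpower (x ^ 2 + 1 ^ 2) (sigma / 2 - 1 - 1))
  by (rewrite (Rpower_pred _ (sigma / 2 - 1)) by assumption; field; lra).
assert (e2 : Rpower (x ^ 2 + 1 ^ 2) (sigma / 2)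
  = (x ^ 2 + 1 ^ 2) * Rpower (x ^ 2 + 1 ^ 2) (sigma / 2 - 1))
  by (rewrite (Rpower_pred _ (sigma / 2)) by assumption; field; lra).
split; [apply Rmult_lt_0_compat; [assumption | apply exp_pos] |].
split; [| split].
- rewrite (profile_at_1 _ _ _ x (d_a_profile _ _ _ _ h hg) hx).
  unfold dg. rewrite e1. ring.
- rewrite (profile_at_1 _ _ _ x (d_b_profile _ _ _ _ h hg) hx).
  unfold g, dg. rewrite e2, e1. ring.
- intros w. rewrite (second_along_profile w _ _ _ _ _ x h hg hdg hx).
  unfold g, dg, ddg. rewrite e2, e1. field.
Qed.

(** * Reduction of the MPF conditions to the differential inequality *)

Lemma no_MPF sigma (hs : 0 < sigma) w :
  9899 / 1000 <= sigma -> ~ MPF (A_power_velocity sigma hs) w.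
Proof.
intros hsigma M.
destruct (mpf_hom _ _ M) as [chi [_ [hom [hchi _]]]].
specialize (hchi (A_power_contracting sigma hs)).
destruct (C2_is_derive_restriction w (mpf_C2 _ _ M)) as [hphi hp].
set (phi := fun x => w x 1) in *. set (p := fun x => d_a w x 1) in *.
set (p' := fun x => d_a (d_a w) x 1) in *.
assert (hw : profile chi w phi) by now apply homogeneous_profile.
set (q := fun x => chi * phi x - x * p x).
set (q' := fun x => (chi - 1) * p x - x * p' x).
assert (hq : forall x, 0 < x -> is_derive q x (q' x))
  by exact (is_derive_d_b_profile chi phi p p' hphi hp).
assert (hdb : forall x, 0 < x -> d_b w x 1 = q x)
  by (intros x hx; exact (profile_at_1 _ _ _ x (d_b_profile _ _ _ _ hw hphi) hx)).
assert (halpha : forall x, 0 < x -> alpha w x 1 = - p x / q x)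
  by (intros x hx; unfold alpha; rewrite hdb by assumption; reflexivity).
(* Together with [q x = chi * phi x - x * p x] these signs give [0 < - x * p x < q x], that is,
   [0 < beta < 1]. *)
assert (signs : forall x, 0 < x < 1 -> 0 < chi * phi x /\ p x < 0 /\ 0 < q x).
{ intros x hx.
  assert (h1 : 0 < phi x) by (apply (mpf_pos _ _ M); lra).
  assert (h2 : p x < 0) by (apply (mpf_d_a_neg _ _ M); lra).
  assert (0 < chi * phi x) by now apply Rmult_lt_0_compat.
  unfold q. repeat split; nra. }
apply (no_subsolution (fun x => x * (- p x / q x))
  (fun x => 1 * (- p x / q x)
    + x * ((- p' x * q x - - p x * q' x) / q x ^ 2))).
- intros x hx. destruct (signs x hx) as [_ [_ hqx]].
  apply (is_derive_mult (fun x => x) (fun x => - p x / q x)).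
  + apply (is_derive_id (K := R_AbsRing)).
  + apply (is_derive_div (fun x => - p x)).
    * apply (is_derive_opp p), hp; lra.
    * apply hq; lra.
    * lra.
  + intros; apply Rmult_comm.
- intros x hx. destruct (signs x hx) as [h1 [h2 h3]].
  replace (x * (- p x / q x)) with (x * - p x / q x) by (field; lra).
  split.
  + apply Rdiv_lt_0_compat; [apply Rmult_lt_0_compat; lra | assumption].
  + apply Rlt_div_l; [lra |]. unfold q. lra.
- intros x hx. destruct (signs x hx) as [h1 [h2 h3]].
  apply Rle_trans with (rate sigma x (x * (- p x / q x)));
    [| now apply rate_decr].
  destruct (A_power_reduced sigma x hs (proj1 hx)) as [K [hK [eFa [eFb eF]]]].
  assert (hG := mpf_G _ _ M x 1 (proj1 hx) Rlt_0_1 (Rlt_not_eq _ _ (proj2 hx))).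
  unfold G_term in hG. change (nv_fun (A_power_velocity sigma hs))
    with (A_power sigma) in hG.
  rewrite eFa, eFb, eF in hG.
  rewrite (second_along_profile w chi w phi p p' x hw hphi hp (proj1 hx)) in hG.
  rewrite hdb in hG by lra. change (d_a w x 1) with (p x) in hG.
  rewrite halpha in hG by lra.
  set (al := - p x / q x) in *.
  set (dal := (- p' x * q x - - p x * q' x) / q x ^ 2).
  assert (hal : 0 < al) by (apply Rdiv_lt_0_compat; lra).
  assert (ep : p x = - al * q x) by (unfold al; field; lra).
  assert (ephi : chi * phi x = q x * (1 - x * al))
    by (unfold al, q; field; unfold q in h3; lra).
  (* Differentiating [w_a + alpha * w_b = 0] along [(1, alpha)] gives second derivative
     [- w_b * (alpha_a + alpha * alpha_b)], and [alpha_b = - x * alpha_a] at [b = 1] since [alpha]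
     has degree 0. *)
  assert (ew : p' x * (1 - x * al) ^ 2
      + 2 * (chi - 1) * p x * al * (1 - x * al)
      + chi * (chi - 1) * phi x * al ^ 2 = - q x * dal * (1 - x * al)).
  { replace (chi * (chi - 1) * phi x) with ((chi - 1) * (chi * phi x)) by ring.
    rewrite ephi. unfold dal, q'. rewrite ep. field. lra. }
  rewrite ew, ep in hG.
  (* [B] is [G_term] stripped of the positive factor [q x * K / al ^ 2]; multiplied by
     [x ^ 2 / (1 + x ^ 2)] it becomes the inequality for [beta]. *)
  set (B := (1 + x ^ 2) * (1 + al ^ 2) + (sigma - 2) * (x + al) ^ 2
    + (1 + x ^ 2) * dal * (1 - x * al)
    - 2 * (1 + x ^ 2) * (x + al) / (1 - x)).
  assert (hB : B <= 0).
  { apply Rnot_lt_le. intros hB. apply (Rle_not_lt _ _ hG).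
    apply Rlt_le_trans with (/ al ^ 2 * (q x * K * B)).
    - repeat apply Rmult_lt_0_compat; try assumption.
      apply Rinv_0_lt_compat, pow_lt, hal.
    - right. unfold B. field. lra. }
  apply Rminus_le.
  replace (x * (1 * al + x * dal) * (1 - x * al) - rate sigma x (x * al))
    with (x ^ 2 * B / (1 + x ^ 2)) by (unfold B, rate; field; split; nra).
  apply Rle_div_l; nra.
Qed.

Theorem theorem9p3 :
  forall (sigma : R) (hs : 0 < sigma),
    (11 <= sigma ->
       ~ exists w : R -> R -> R, MPF (A_power_velocity sigma hs) w) /\
    (9899 / 1000 <= sigma ->
       ~ exists w : R -> R -> R, MPF (A_power_velocity sigma hs) w).
Proof.
intros sigma hs. split; intros h [w M]; apply (no_MPF sigma hs w); trivial; lra.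
Qed.
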